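(* Let $n\ge k\ge r\ge 1$ be integers, let $M(r)=\{\sigma\in\mathcal S_n\mid |\mathrm{Move}(\sigma)\cap[k]|=r\}$, let $T=[n]\setminus[k]$, and let $\mathcal S_n=\bigcup_{i=1}^{l}\mathcal S_n(T)\alpha_i$ be the decomposition of $\mathcal S_n$ into the disjoint union of all right cosets of $\mathcal S_n(T)$, with $\alpha_i\in\mathcal S_n$ coset representatives, so $l=n!/(n-k)!$. Then the following hold. (a) $(\mathcal S_n(T)\alpha_1,\dots,\mathcal S_n(T)\alpha_l)$ is an equitable partition of $\Gamma(\mathcal S_n,M(r))$. (b) Let $Q$ be the quotient matrix of $(\mathcal S_n(T)\alpha_1,\dots,\mathcal S_n(T)\alpha_l)$ and let $A_{n,k,r}$ be the adjacency matrix of the arrangement graph $A(n,k,r)$, where the coset $\mathcal S_n(T)\alpha_i$ is identified with the vertex $(\alpha_i(1),\alpha_i(2),\dots,\alpha_i(k))$ of $A(n,k,r)$. Then $Q=(n-k)!\,A_{n,k,r}$. (c) $A(n,k,r)$ is a $\frac{|M(r)|}{(n-k)!}$-regular graph. (d) If $\lambda$ is an eigenvalue of $A(n,k,r)$, then $(n-k)!\,\lambda$ is an eigenvalue of $\Gamma(\mathcal S_n,M(r))$.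
   Context: $\mathcal S_n$ is the symmetric group on $[n]=\{1,\dots,n\}$, with products composed from left to right: $\alpha\beta=\beta\circ\alpha$, i.e. $(\alpha\beta)(i)=\beta(\alpha(i))$; for example $(1\ 2\ 3)(2\ 3)=(1\ 3)$. For $\alpha\in\mathcal S_n$, $\mathrm{Move}(\alpha)=\{i\in[n]\mid\alpha(i)\neq i\}$; for $T\subseteq[n]$, $\mathcal S_n(T)=\{\alpha\in\mathcal S_n\mid\mathrm{Move}(\alpha)\subseteq T\}$. A right coset of a subgroup $H$ is a set $H\alpha=\{h\alpha\mid h\in H\}$. For a finite group $G$ and an inverse closed subset $S\subseteq G$, the Cayley graph $\Gamma(G,S)$ has vertex set $G$, with $u,v$ adjacent if and only if $v=su$ for some $s\in S$. For $1\le r\le k\le n$, the arrangement graph $A(n,k,r)$ has as vertices all vectors $(p_1,\dots,p_k)$ with $p_i\in[n]$ pairwise distinct, two vertices being adjacent if and only if they differ in exactly $r$ positions. An equitable partition of a graph $\Gamma$ is a partition $(V_1,\dots,V_m)$ of its vertex set such that for all $i,j$ (possibly $i=j$) every vertex in $V_i$ has the same number $q_{ij}$ of neighbours in $V_j$; its quotient matrix is the $m\times m$ matrix $(q_{ij})$. Eigenvalues of a graph are those of its adjacency matrix. *)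

(* Defs.v *)
From mathcomp Require Import all_boot all_order all_algebra all_fingroup.

Set Implicit Arguments.
Unset Strict Implicit.
Unset Printing Implicit Defensive.

Import GRing.Theory Num.Theory.

(* A finite graph is given by its adjacency relation, a rel V on a finType V. *)

Definition nbrs (V : finType) (e : rel V) (u : V) : {set V} := [set v | e u v].

Definition regular (V : finType) (e : rel V) (d : nat) : Prop :=
  forall u, #|nbrs e u| = d.

(* The matrix of e with rows and columns indexed through a listing f of the
   vertices; it is an adjacency matrix of e as soon as f is bijective. *)
Definition adj_along (R : pzSemiRingType) (V : finType) (e : rel V)
    (m : nat) (f : 'I_m -> V) : 'M[R]_m :=
  (\matrix_(i, j) (e (f i) (f j))%:R)%R.

Definition adj_mx (R : pzSemiRingType) (V : finType) (e : rel V) : 'M[R]_#|V| :=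
  adj_along R e (fun i : 'I_#|V| => enum_val i).

Definition graph_eigenvalue (R : fieldType) (V : finType) (e : rel V)
    (lambda : R) : bool :=
  eigenvalue (adj_mx R e) lambda.

(* [partition] excludes empty parts; injectivity excludes repeated ones. *)
Definition ordered_partition (V : finType) (m : nat)
    (W : 'I_m -> {set V}) : Prop :=
  injective W /\ partition [set W i | i : 'I_m] [set: V].

Definition equitable (V : finType) (e : rel V) (m : nat)
    (W : 'I_m -> {set V}) : Prop :=
  ordered_partition W /\
  forall (i j : 'I_m) (u v : V), u \in W i -> v \in W i ->
    #|nbrs e u :&: W j| = #|nbrs e v :&: W j|.

(* When W is equitable its parts are nonempty, so such a Q exists and is
   unique. *)
Definition is_quotient_mx (R : pzSemiRingType) (V : finType) (e : rel V)
    (m : nat) (W : 'I_m -> {set V}) (Q : 'M[R]_m) : Prop :=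
  forall (i j : 'I_m) (u : V), u \in W i -> Q i j = (#|nbrs e u :&: W j|%:R)%R.

Definition cayley (gT : finGroupType) (S : {set gT}) : rel gT :=
  fun u v => [exists s in S, v == (s * u)%g].

(* [perm] composes from left to right: (s * t) x = t (s x) (permM).  The set
   [n] is 'I_n = {0, ..., n-1}, so that [k] is {0, ..., k-1}.  The group
   S_n(T) is the library's Sym T. *)

Definition Move (n : nat) (s : 'S_n) : {set 'I_n} := [set i | s i != i].

Definition initseg (n k : nat) : {set 'I_n} := [set i : 'I_n | i < k].

Definition Mset (n k r : nat) : {set 'S_n} :=
  [set s : 'S_n | #|Move s :&: initseg n k| == r].

Lemma Mset_inv_closed (n k r : nat) (s : 'S_n) :
  s \in Mset n k r -> (s^-1)%g \in Mset n k r.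
Proof.
rewrite !inE; suff -> : Move (s^-1)%g = Move s by [].
apply/setP => i; rewrite !inE; congr (~~ _).
by rewrite -(inj_eq (@perm_inj _ s)) permKV eq_sym.
Qed.

Definition arr_vertex (n k : nat) :=
  {p : {ffun 'I_k -> 'I_n} | injectiveb p}.

Definition arrangement (n k r : nat) : rel (arr_vertex n k) :=
  fun p q => #|[set i | val p i != val q i]| == r.

Lemma vertex_of_perm_subproof (n k : nat) (hkn : k <= n) (a : 'S_n) :
  injectiveb [ffun i : 'I_k => a (widen_ord hkn i)].
Proof.
apply/injectiveP => i j; rewrite !ffunE => /perm_inj /(congr1 val) /= ij.
exact: val_inj.
Qed.

Definition vertex_of_perm (n k : nat) (hkn : k <= n) (a : 'S_n) :
    arr_vertex n k :=
  exist (fun p : {ffun 'I_k -> 'I_n} => injectiveb p)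
    [ffun i : 'I_k => a (widen_ord hkn i)]
    (vertex_of_perm_subproof hkn a).

(* Main.v *)
Require Import Defs.
From mathcomp Require Import all_boot all_order all_algebra all_fingroup.

Set Implicit Arguments.
Unset Strict Implicit.
Unset Printing Implicit Defensive.

(** The map [vertex_of_perm] restricting a permutation [a] of [n] to the
    vector (a(1), ..., a(k)) explains everything at once.

    Two permutations have the same restriction exactly when they lie in the
    same right coset of the pointwise stabiliser of [k], which is S_n(T); so
    the cosets are the fibres of the restriction and all have (n - k)!
    elements ([coset_vertex_of_perm], [card_fibre_vertex_of_perm]).  Moreover
    [v = s u] with [s] moving exactly [r] points of [k] means that [u] and [v]
    disagree at exactly [r] points of [k]; so the Cayley graph is the
    pullback of the arrangement graph along the restriction
    ([cayley_arrangement]).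

    For any pullback of a graph along a map whose fibres all have [c]
    elements, neighbourhoods are full preimages of neighbourhoods.  Hence the
    fibres form an equitable partition with quotient matrix [c] times the
    adjacency matrix, degrees are multiplied by [c], and an eigenvector made
    constant along the fibres stays an eigenvector, with its eigenvalue
    multiplied by [c].

    The restriction is onto by counting: distinct cosets give distinct
    vectors, and there are n! / (n - k)! of both. *)

(** * Eigenvectors as functions on the vertices *)

(** Being an eigenvector is an equality between sums over the vertices, with
    no reference to the enumeration that indexes the adjacency matrix. *)
Lemma graph_eigenvalueP (R : fieldType) (W : finType) (g : rel W)
    (lambda : R) :
  reflect (exists2 y : W -> R,
             forall v, (\sum_u y u * (g u v)%:R = lambda * y v)%R
           & exists v, y v != 0%R)
          (graph_eigenvalue g lambda).
Proof.
apply: (iffP eigenvalueP) => [[x xg nz_x] | [y yg [v nz_yv]]].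
  exists (fun v => x 0%R (enum_rank v)) => [v|].
    have /matrixP/(_ 0%R (enum_rank v)) := xg.
    rewrite !mxE => <-; rewrite big_enum_val /=.
    by apply: eq_bigr => i _; rewrite !mxE enum_valK enum_rankK.
  by have /rV0Pn[i nz_xi] := nz_x; exists (enum_val i); rewrite enum_valK.
exists (\row_i y (enum_val i))%R.
  apply/rowP => i; rewrite !mxE -yg [RHS]big_enum_val /=.
  by apply: eq_bigr => j _; rewrite !mxE.
by apply/rV0Pn; exists (enum_rank v); rewrite mxE enum_rankK.
Qed.

(** * Pullbacks of graphs along maps with fibres of constant size *)

Section Pullback.

Variables (U V : finType) (f : U -> V) (c : nat) (d : rel U) (e : rel V).
Hypothesis d_pullback : forall u v, d u v = e (f u) (f v).

Lemma nbrs_pullback (u : U) : nbrs d u = f @^-1: nbrs e (f u).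
Proof. by apply/setP => v; rewrite !inE d_pullback. Qed.

Hypothesis card_fibre : forall p, #|f @^-1: [set p]| = c.

Lemma sum_over_fibres (R : pzSemiRingType) (F : V -> R) :
  (\sum_u F (f u) = c%:R * \sum_p F p)%R.
Proof.
rewrite (partition_big f predT) //= GRing.mulr_sumr; apply: eq_bigr => p _.
rewrite (eq_bigr (fun=> F p)) => [|u /eqP-> //].
rewrite GRing.sumr_const GRing.mulr_natl -(card_fibre p).
by congr (_ *+ _)%R; apply: eq_card => u; rewrite !inE.
Qed.

Lemma card_preimset_fibres (A : {set V}) : #|f @^-1: A| = c * #|A|.
Proof.
rewrite -sum1_card (partition_big f (mem A)) => [|u]; last by rewrite inE.
rewrite mulnC -sum_nat_const; apply: eq_bigr => p Ap.
rewrite sum1_card -(card_fibre p); apply: eq_card => u.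
by rewrite unfold_in !inE; apply: andb_idl => /eqP->.
Qed.

Lemma card_nbrs_pullback (u : U) : #|nbrs d u| = c * #|nbrs e (f u)|.
Proof. by rewrite nbrs_pullback card_preimset_fibres. Qed.

Lemma card_nbrs_fibre (u : U) (p : V) :
  #|nbrs d u :&: f @^-1: [set p]| = c * e (f u) p.
Proof.
rewrite nbrs_pullback -preimsetI card_preimset_fibres; congr (_ * _).
case: (boolP (e (f u) p)) => [eup | neup].
  have /setIidPr -> : [set p] \subset nbrs e (f u) by rewrite sub1set inE.
  exact: cards1.
apply: eq_card0 => q; rewrite !inE; apply/andP => -[euq /eqP qp].
by rewrite -qp euq in neup.
Qed.

(** An eigenvector [y] lifts to [y \o f]: in the sum over the neighbours of a
    vertex above, each neighbour below is met [c] times.  The fibres being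
    nonempty, the lift is nonzero. *)
Lemma graph_eigenvalue_pullback (R : fieldType) (lambda : R) :
  0 < c -> graph_eigenvalue e lambda ->
  graph_eigenvalue d (c%:R * lambda)%R.
Proof.
move=> c_gt0 /graph_eigenvalueP[y ye [p nz_yp]].
apply/graph_eigenvalueP; exists (y \o f) => [v|] /=.
  rewrite (eq_bigr (fun u => y (f u) * (e (f u) (f v))%:R)%R) => [|u _].
    rewrite (sum_over_fibres (fun q => y q * (e q (f v))%:R)%R) ye.
    by rewrite GRing.mulrA.
  by rewrite d_pullback.
have /card_gt0P[u] : 0 < #|f @^-1: [set p]| by rewrite card_fibre.
by rewrite !inE => /eqP fu; exists u; rewrite /= fu.
Qed.

End Pullback.

(** * Restriction of permutations to an initial segment *)

Section Restriction.

Variables (n k : nat) (hkn : k <= n).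

Let T : {set 'I_n} := [set: 'I_n] :\: initseg n k.
Let restr : 'S_n -> arr_vertex n k := vertex_of_perm hkn.

Lemma vertex_of_perm_eqP (a b : 'S_n) :
  reflect (forall i : 'I_n, i < k -> a i = b i) (restr a == restr b).
Proof.
apply: (iffP eqP) => [/(congr1 val)/ffunP ab i ik | ab].
  by have := ab (Ordinal ik); rewrite !ffunE (_ : widen_ord _ _ = i) //;
    apply: val_inj.
by apply/val_inj/ffunP => i; rewrite !ffunE ab /=.
Qed.

(** [b a^-1] fixes [i] exactly when [b] and [a] agree at [i], and S_n(T) is
    the pointwise stabiliser of the complement of [T]. *)
Lemma coset_vertex_of_perm (a : 'S_n) :
  (Sym T :* a)%g = restr @^-1: [set restr a].
Proof.
apply/setP => b; rewrite mem_rcoset !inE.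
apply/subsetP/vertex_of_perm_eqP => [ba i ik | ba i].
  apply/eqP; rewrite -(inj_eq (@perm_inj _ a^-1)) permK -permM.
  by apply: contraLR ik => /ba; rewrite !inE andbT.
rewrite !inE andbT; apply: contra => /ba /(congr1 a^-1%g).
by rewrite permM permK => ->.
Qed.

Lemma card_Sym_compl_initseg : #|Sym T| = (n - k)`!.
Proof.
rewrite card_Sym; congr (_`!).
rewrite /T setTD cardsCs setCK card_ord; congr (n - _).
rewrite -[RHS]card_ord.
have /card_imset <- : injective (widen_ord hkn).
  by move=> i j /(congr1 val)/= ij; apply: val_inj.
apply: eq_card => i; rewrite !inE; apply/idP/imsetP => [ik | [j _ ->]] //=.
by exists (Ordinal ik) => //; apply: val_inj.
Qed.

Lemma card_arr_vertex : #|{: arr_vertex n k}| = n`! %/ (n - k)`!.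
Proof.
rewrite card_sig -(ffact_fact hkn) mulnK ?fact_gt0 //.
rewrite -[in RHS](card_ord n) -[in RHS](card_ord k) -card_inj_ffuns.
by apply: eq_card => p; rewrite !inE.
Qed.

(** Read at [i], the equation [v = s u] says v(i) = u(s(i)), so [s] moves [i]
    exactly when [u] and [v] disagree there. *)
Lemma cayley_arrangement (r : nat) (u v : 'S_n) :
  cayley (Mset n k r) u v = @arrangement n k r (restr u) (restr v).
Proof.
have -> : cayley (Mset n k r) u v = ((v * u^-1)%g \in Mset n k r).
  apply/existsP/idP => [[s /andP[Ms /eqP->]] | Ms]; first by rewrite mulgK.
  by exists (v * u^-1)%g; rewrite Ms mulgKV eqxx.
rewrite inE /arrangement; congr (_ == r).
have /card_imset <- : injective (widen_ord hkn).
  by move=> i j /(congr1 val)/= ij; apply: val_inj.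
have moveE i : ((v * u^-1)%g i != i) = (u i != v i).
  by rewrite -(inj_eq (@perm_inj _ u)) permM permKV eq_sym.
apply: eq_card => i; rewrite !inE moveE.
apply/andP/imsetP => [[uv ik] | [j]].
  exists (Ordinal ik); last exact: val_inj.
  by rewrite inE !ffunE (_ : widen_ord _ _ = i) //; apply: val_inj.
by rewrite inE !ffunE => uv ->; split; last exact: (ltn_ord j).
Qed.

End Restriction.

(** * Systems of coset representatives *)

Section Transversal.

Variables (n k : nat) (hkn : k <= n) (l : nat) (alpha : 'I_l -> 'S_n).

Let T : {set 'I_n} := [set: 'I_n] :\: initseg n k.
Let W (i : 'I_l) : {set 'S_n} := (Sym T :* alpha i)%g.
Let vertex (i : 'I_l) : arr_vertex n k := vertex_of_perm hkn (alpha i).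

Hypothesis W_inj : injective W.
Hypothesis W_rcosets : [set W i | i : 'I_l] = rcosets (Sym T) [set: 'S_n].

Lemma card_transversal : l = n`! %/ (n - k)`!.
Proof.
rewrite -card_Sn -(card_Sym_compl_initseg hkn) -cardsT divgS ?subsetT //.
by rewrite /indexg -W_rcosets card_imset // card_ord.
Qed.

(** Injective because a coset is recovered as the fibre over its vertex, hence
    bijective since both sides have n! / (n - k)! elements.  This also yields
    that [vertex_of_perm] is onto. *)
Lemma vertex_bij : bijective vertex.
Proof.
apply: inj_card_bij => [i j ij|]; last first.
  by rewrite card_arr_vertex // card_ord -card_transversal.
apply: W_inj; rewrite /W !(coset_vertex_of_perm hkn).
by rewrite -/(vertex i) ij.
Qed.

Lemma card_fibre_vertex_of_perm (p : arr_vertex n k) :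
  #|vertex_of_perm hkn @^-1: [set p]| = (n - k)`!.
Proof.
have [inv _ invK] := vertex_bij; rewrite -[p]invK.
by rewrite -coset_vertex_of_perm card_rcoset (card_Sym_compl_initseg hkn).
Qed.

Lemma transversal_ordered_partition : ordered_partition W.
Proof. by split; rewrite // W_rcosets rcosets_partition ?subsetT. Qed.

End Transversal.

Theorem theorem4p2 (R : numFieldType) (n k r : nat)
    (hkn : k <= n) (hrk : r <= k) (hr : 1 <= r)
    (l : nat) (alpha : 'I_l -> 'S_n) :
  let T : {set 'I_n} := [set: 'I_n] :\: initseg n k in
  let W : 'I_l -> {set 'S_n} := fun i => (Sym T :* alpha i)%g in
  let vertex : 'I_l -> arr_vertex n k :=
    fun i => vertex_of_perm hkn (alpha i) in
  injective W ->
  [set W i | i : 'I_l] = rcosets (Sym T) [set: 'S_n] ->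
  [/\ l = n`! %/ (n - k)`!,
      equitable (cayley (Mset n k r)) W,
      bijective vertex /\
      (forall Q : 'M[R]_l,
         is_quotient_mx (cayley (Mset n k r)) W Q ->
         Q = ((n - k)`!%:R *: adj_along R (@arrangement n k r) vertex)%R),
      (n - k)`! %| #|Mset n k r| /\
      regular (@arrangement n k r) (#|Mset n k r| %/ (n - k)`!)
    & forall lambda : R,
        graph_eigenvalue (@arrangement n k r) lambda ->
        graph_eigenvalue (cayley (Mset n k r)) ((n - k)`!%:R * lambda)%R].
Proof.
move=> T W vertex W_inj W_rcosets.
have vertexbij : bijective vertex := vertex_bij hkn W_inj W_rcosets.
have fibre := card_fibre_vertex_of_perm hkn W_inj W_rcosets.
have pullback := @cayley_arrangement n k hkn r.
have nbrsW i j u : u \in W i ->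
    #|nbrs (cayley (Mset n k r)) u :&: W j|
      = (n - k)`! * @arrangement n k r (vertex i) (vertex j).
  rewrite /W !(coset_vertex_of_perm hkn) !inE => /eqP pu.
  by rewrite (card_nbrs_fibre pullback fibre) pu.
have degM p : #|Mset n k r| = (n - k)`! * #|nbrs (@arrangement n k r) p|.
  have [inv _ invK] := vertexbij; rewrite -[p]invK.
  rewrite -(card_nbrs_pullback pullback fibre).
  (* The neighbours of [a] in the Cayley graph form the translate [M(r) a]. *)
  rewrite -(card_rcoset (Mset n k r) (alpha (inv p))).
  apply: eq_card => v; rewrite inE mem_rcoset.
  apply/idP/existsP => [Mv | [s /andP[Ms /eqP->]]]; last by rewrite mulgK.
  by exists (v * (alpha (inv p))^-1)%g; rewrite Mv mulgKV eqxx.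
split.
- exact: (card_transversal hkn W_inj W_rcosets).
- split; first exact: (transversal_ordered_partition W_inj W_rcosets).
  by move=> i j u v Wu Wv; rewrite !(nbrsW i).
- split=> // Q Qquot; apply/matrixP => i j; rewrite !mxE.
  rewrite (Qquot i j (alpha i)) ?(nbrsW i) ?GRing.natrM //.
    exact: rcoset_refl.
  exact: rcoset_refl.
- split; last by move=> p; rewrite (degM p) mulKn ?fact_gt0.
  by rewrite (degM (vertex_of_perm hkn 1%g)) dvdn_mulr.
- by move=> lambda; apply: (graph_eigenvalue_pullback pullback fibre);
    rewrite fact_gt0.
Qed.
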